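(* Let $g$ be a (nonnegative) radial, decreasing function on $\mathbb{R}^n$. For each $p\in(2,\infty]$ one has \[ \|M_{\nu_n}g\|_{L^{p,\infty}(\nu_n)}^{\ast}\leq \frac{p+2}{p-2}\,\|g\|_{L^p(\nu_n)}, \] where for $p=\infty$ the constant $\frac{p+2}{p-2}$ is interpreted as $1$.
   Context: $B(x,R)$ denotes the Euclidean ball in $\mathbb{R}^n$ centred at $x$ with radius $R$. $\nu_n$ is Lebesgue measure restricted to the Euclidean unit ball of $\mathbb{R}^n$ centred at the origin. The maximal function associated to a Radon measure $\mu$ is \[ M_\mu g(x)=\sup_{R>0,\ \mu(B(x,R))>0}\frac1{\mu(B(x,R))}\int_{B(x,R)}|g(y)|\,d\mu(y). \] A radial, decreasing function is one of the form $g(x)=g_0(|x|)$ with $g_0:[0,\infty)\to[0,\infty]$ non-increasing and finite on $(0,\infty)$. The weak $L^p$ quasinorm is $\|f\|_{L^{p,\infty}(\mu)}^\ast=\sup_{\lambda>0}\lambda\,\mu(\{|f|>\lambda\})^{1/p}$ for $p<\infty$, and $\|f\|_{L^{\infty,\infty}(\mu)}^\ast=\|f\|_{L^\infty(\mu)}$. *)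

(* Defs.v *)
From HB Require Import structures.
From mathcomp Require Import all_boot all_order all_algebra.
From mathcomp Require Import all_classical all_reals all_analysis.
From mathcomp Require Import measurable_realfun.

Set Implicit Arguments.
Unset Strict Implicit.
Unset Printing Implicit Defensive.

Import Order.TTheory GRing.Theory Num.Theory.
Import numFieldNormedType.Exports.

Local Open Scope classical_set_scope.
Local Open Scope ring_scope.
Local Open Scope ereal_scope.

(* The library equips tuples with the product sigma-algebra, which here is the
   Borel sigma-algebra of R^n. *)
Notation Rn R n := (n.-tuple (measurableTypeR R)).

Section lebesgue_cons.
Context (R : realType) (n : nat).
Variable m : {sigma_finite_measure set (Rn R n) -> \bar R}.

Definition Rn_cons (z : measurableTypeR R * Rn R n) : Rn R n.+1 :=
  [tuple of z.1 :: z.2].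

Lemma measurable_Rn_cons : measurable_fun [set: _] Rn_cons.
Proof. exact: measurable_cons. Qed.

Definition lebesgue_cons : set (Rn R n.+1) -> \bar R :=
  pushforward (@lebesgue_measure R \x m) Rn_cons.

Let lebesgue_cons0 : lebesgue_cons set0 = 0.
Proof. by rewrite /lebesgue_cons /pushforward preimage_set0 measure0. Qed.

Let lebesgue_cons_ge0 A : 0 <= lebesgue_cons A.
Proof. exact: (measure_ge0 (@lebesgue_measure R \x m)). Qed.

Let lebesgue_cons_sigma_additive : semi_sigma_additive lebesgue_cons.
Proof.
move=> F mF tF mUF; rewrite /lebesgue_cons /pushforward preimage_bigcup.
apply: measure_semi_sigma_additive.
- by move=> k; rewrite -[X in measurable X]setTI; exact: measurable_Rn_cons.
- apply/trivIsetP => /= i j _ _ ij; rewrite -preimage_setI.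
  by move/trivIsetP : tF => /(_ _ _ _ _ ij) ->//; rewrite preimage_set0.
- rewrite -preimage_bigcup -[X in measurable X]setTI.
  exact: measurable_Rn_cons.
Qed.

HB.instance Definition _ := isMeasure.Build _ _ _ lebesgue_cons
  lebesgue_cons0 lebesgue_cons_ge0 lebesgue_cons_sigma_additive.

Let Rn_uncons (x : Rn R n.+1) : measurableTypeR R * Rn R n :=
  (tnth x ord0, [tuple of behead x]).

Let Rn_consK : cancel Rn_cons Rn_uncons.
Proof. by case=> a x; congr pair; apply: val_inj. Qed.

Let measurable_Rn_uncons : measurable_fun [set: _] Rn_uncons.
Proof.
apply: measurable_fun_pair; first exact: measurable_tnth.
exact: measurable_behead.
Qed.

Let lebesgue_cons_sigma_finite : sigma_finite setT lebesgue_cons.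
Proof.
have /sigma_finiteP[F [FT ndF Foo]] := sigma_finiteT (@lebesgue_measure R).
have /sigma_finiteP[G [GT ndG Goo]] := sigma_finiteT m.
exists (fun k => Rn_uncons @^-1` (F k `*` G k)).
  rewrite -preimage_bigcup (_ : \bigcup_k _ = setT) ?preimage_setT//.
  apply/seteqP; split=> // -[a x] _.
  have [i _ Fia] : (\bigcup_k F k) a by rewrite -FT.
  have [j _ Gjx] : (\bigcup_k G k) x by rewrite -GT.
  exists (maxn i j) => //; split => /=.
  - by move: a Fia; exact/subsetPset/ndF/leq_maxl.
  - by move: x Gjx; exact/subsetPset/ndG/leq_maxr.
move=> k; have [mFk Fkoo] := Foo k; have [mGk Gkoo] := Goo k; split.
  rewrite -[X in measurable X]setTI; apply: measurable_Rn_uncons => //.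
  exact: measurableX.
rewrite /lebesgue_cons /pushforward -comp_preimage.
rewrite (_ : _ \o _ = id); last by apply/funext => z; exact: Rn_consK.
by rewrite preimage_id product_measure1E// lte_mul_pinfty// ge0_fin_numE.
Qed.

HB.instance Definition _ := Measure_isSigmaFinite.Build _ _ _ lebesgue_cons
  lebesgue_cons_sigma_finite.

End lebesgue_cons.

Fixpoint lebesgue_Rn (R : realType) (n : nat) :
    {sigma_finite_measure set (Rn R n) -> \bar R} :=
  match n with
  | 0%N => \d_([tuple] : Rn R 0)
  | k.+1 => lebesgue_cons (lebesgue_Rn R k)
  end.

(* Together with sigma-finiteness, this determines lebesgue_Rn on Borel sets. *)
Lemma lebesgue_Rn_box (R : realType) (n : nat)
    (A : 'I_n -> set (measurableTypeR R)) : (forall i, measurable (A i)) ->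
  lebesgue_Rn R n [set x | forall i, A i (tnth x i)]
  = \prod_(i < n) lebesgue_measure (A i).
Proof.
elim: n A => [|n IH] A mA.
  rewrite big_ord0 /= diracE (_ : _ \in _ = true)//.
  by apply/mem_set => -[].
rewrite big_ord_recl -IH//= /lebesgue_cons /pushforward.
rewrite (_ : _ @^-1` _ = A ord0 `*`
    [set x : Rn R n | forall i, A (lift ord0 i) (tnth x i)]); last first.
  apply/seteqP; split=> -[a x] /= => [Aax|[A0 Ax] i].
    split=> [|i]; first exact: (Aax ord0).
    by have := Aax (lift ord0 i); rewrite tnthS.
  case: (unliftP ord0 i) => [j ->|-> //].
  by rewrite tnthS.
rewrite product_measure1E//.
rewrite (_ : [set x | _] =
    \bigcap_(i in [set: 'I_n]) ((@tnth _ _ ^~ i) @^-1` A (lift ord0 i))).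
  apply: fin_bigcap_measurable => // i _.
  by rewrite -[X in measurable X]setTI; exact: measurable_tnth.
by apply/seteqP; split=> x /= Ax => [i _|i]; exact: Ax.
Qed.

Definition enorm (R : realType) (n : nat) (x : Rn R n) : R :=
  Num.sqrt (\sum_(i < n) (tnth x i : R) ^+ 2)%R.

Definition Rn_origin (R : realType) (n : nat) : Rn R n :=
  [tuple (0 : R)%R | i < n].

(* Open balls; their boundary spheres are Lebesgue-null when 0 < n. *)
Definition eball (R : realType) (n : nat) (x : Rn R n) (r : R) : set (Rn R n) :=
  [set y | (enorm [tuple (tnth y i - tnth x i : R)%R | i < n] < r)%R].

Lemma measurable_eball (R : realType) (n : nat) (x : Rn R n) (r : R) :
  measurable (eball x r).
Proof.
pose f (y : Rn R n) : R := enorm [tuple (tnth y i - tnth x i : R)%R | i < n].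
rewrite (_ : eball x r = [set: _] `&` f @^-1` [set s | (s < r)%R]); last first.
  by rewrite setTI.
have -> : [set s : R | (s < r)%R] = `]-oo, r[%classic.
  by apply/seteqP; split=> s /=; rewrite in_itv.
suff mf : measurable_fun [set: Rn R n] f.
  by apply: mf => //; exact: measurable_itv.
apply: (measurableT_comp (f := @Num.sqrt R)).
  by apply: continuous_measurable_fun; exact: sqrt_continuous.
apply: measurable_sum => i; apply: measurable_funX.
under eq_fun do rewrite tnth_mktuple.
by apply: measurable_funB => //; exact: measurable_tnth.
Qed.

Definition nu (R : realType) (n : nat) : {measure set (Rn R n) -> \bar R} :=
  mrestr (lebesgue_Rn R n) (measurable_eball (Rn_origin R n) 1).

(* Only radii with mu (eball x r) > 0 compete, so no 0^-1 = +oo occurs; for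
   mu = 0 the supremum is over the empty set and equals -oo. *)
Definition maximal (R : realType) (n : nat)
    (mu : {measure set (Rn R n) -> \bar R}) (g : Rn R n -> \bar R)
    (x : Rn R n) : \bar R :=
  ereal_sup [set (mu (eball x r))^-1 * \int[mu]_(y in eball x r) `|g y|
            | r in [set r : R | (0 < r)%R /\ 0 < mu (eball x r)]].

(* Only the values of g0 on [0, +oo[ are constrained and used. *)
Definition radial_decreasing (R : realType) (n : nat) (g : Rn R n -> \bar R) :=
  exists g0 : R -> \bar R,
    [/\ forall r, (0 <= r)%R -> 0 <= g0 r,
        forall r, (0 < r)%R -> g0 r < +oo,
        forall r s, (0 <= r)%R -> (r <= s)%R -> g0 s <= g0 r &
        forall x, g x = g0 (enorm x)].

(* Meant for 0 < p <= +oo; the value at p = -oo is junk. *)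
Definition weak_Lnorm (d : measure_display) (T : measurableType d) (R : realType)
    (mu : {measure set T -> \bar R}) (p : \bar R) (f : T -> \bar R) : \bar R :=
  match p with
  | r%:E => ereal_sup [set l%:E * mu [set x | l%:E < `|f x|] `^ r^-1
                      | l in [set l : R | (0 < l)%R]]
  | _ => Lnorm mu p f
  end.

(* Meant for 2 < p <= +oo; 1 is the limit of (r + 2) / (r - 2) at infinity. *)
Definition weak_constant (R : realType) (p : \bar R) : R :=
  if p is r%:E then (r + 2) / (r - 2) else 1.

(* Main.v *)
From HB Require Import structures.
Require Import Defs.
From mathcomp Require Import all_boot all_order all_algebra.
From mathcomp Require Import all_classical all_reals all_analysis.
From mathcomp Require Import measurable_realfun.
From mathcomp Require Import ring lra.
(** By monotonicity of the profile, [t ^ n |B| g0 t ^ p <= ||g||_p ^ p], so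
    [g] lies below a multiple of [|y| ^ (- n / p)], and it suffices to average
    this power over a ball [B(x, r)]. Writing the average with the layer-cake
    formula, everything reduces to the volume estimate
      |B(x, r) /\ B(0, s^2 |x|)| <= 2 s^n |B(x, r) /\ B(0, |x|)|, 0 < s < 1.
    To see it, cut the small lens by the radical hyperplane of its two spheres:
    each of the two pieces is sent into the large lens by a homothety of ratio
    [1 / s], with a centre depending on the piece. If [k] is the bound on the
    profile at [|x|], integrating [2 (k / l) ^ (p / 2)] over the levels [l > k]
    gives [M g x <= k + 2 k / (p / 2 - 1) = (p + 2) / (p - 2) k]. *)

Set Implicit Arguments.
Unset Strict Implicit.
Unset Printing Implicit Defensive.

Import Order.TTheory GRing.Theory Num.Theory.
Import numFieldNormedType.Exports.

Local Open Scope classical_set_scope.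
Local Open Scope ring_scope.
Local Open Scope ereal_scope.

(** * Monotonicity without measurability *)

(* Neither function is assumed measurable: the integral of a nonnegative
   function is a supremum over the simple functions below it. *)
Lemma ge0_le_integral_nonmeas d (T : measurableType d) (R : realType)
    (mu : {measure set T -> \bar R}) (D : set T) (f g : T -> \bar R) :
  (forall x, D x -> 0 <= f x) -> (forall x, D x -> f x <= g x) ->
  \int[mu]_(x in D) f x <= \int[mu]_(x in D) g x.
Proof.
move=> f0 fg.
have g0 x : D x -> 0 <= g x by move=> Dx; exact: le_trans (f0 _ Dx) (fg _ Dx).
rewrite !ge0_integralE//; apply: le_ereal_sup => _ [h /= hf <-].
exists h => //= x; apply: le_trans (hf x) _.
by rewrite !patchE; case: ifPn => // /set_mem; exact: fg.
Qed.

(* [A] and [B] are arbitrary; this makes it unnecessary to show that the level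
   sets of the maximal function are measurable. *)
Lemma lebesgue_Rn_monotone (R : realType) (n : nat) (A B : set (Rn R n)) :
  A `<=` B -> lebesgue_Rn R n A <= lebesgue_Rn R n B.
Proof.
elim: n A B => [|n IH] A B AB /=.
  rewrite !diracE lee_fin ler_nat.
  case: (boolP (_ \in A)) => // /set_mem/AB/mem_set ->//.
rewrite /lebesgue_cons /pushforward /product_measure1.
apply: ge0_le_integral_nonmeas => x _ //=.
by apply: IH => y; rewrite /xsection/= !inE; exact: AB.
Qed.

(** * Change of Lebesgue measure under homotheties *)

Definition homothety (R : realType) (n : nat) (a : R) (b : Rn R n)
    (y : Rn R n) : Rn R n :=
  [tuple (a * tnth y i + tnth b i)%R | i < n].

Lemma measurable_affine (R : realType) (a b : R) :
  measurable_fun [set: measurableTypeR R]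
    (fun x => (a * x + b)%R : measurableTypeR R).
Proof. by apply: measurable_funD => //; exact: measurable_funM. Qed.

(** [a] times the pushforward of Lebesgue measure agrees with it on half-open intervals, and these
    determine it. *)
Lemma lebesgue_measure_affine (R : realType) (a b : R) (A : set R) :
  (0 < a)%R -> measurable (A : set (measurableTypeR R)) ->
  lebesgue_measure ((fun x : R => a * x + b)%R @^-1` A)
  = a^-1%:E * lebesgue_measure A.
Proof.
move=> a0 mA.
pose m' := mscale (NngNum (ltW a0))
  (pushforward (@lebesgue_measure R)
     (fun x : R => a * x + b : measurableTypeR R)%R).
have mf := @measurable_affine R a b.
suff -> : lebesgue_measure A = m' mf A.
  rewrite /m' /mscale /= /pushforward muleA -EFinM mulVf ?mul1e//.
  by rewrite gt_eqF.
apply: lebesgue_measure_unique => //= _ [[u v] _ <-].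
rewrite /m' /mscale /= /pushforward.
rewrite (_ : _ @^-1` _ = `](u - b) / a, (v - b) / a]%classic)%R; last first.
  apply/seteqP; split => x /=; rewrite !in_itv/= ltr_pdivrMr// ler_pdivlMr//;
    by rewrite ltrBlDr lerBrDr (mulrC x).
rewrite !lebesgue_measure_itv/= !lte_fin ltr_pM2r ?invr_gt0// ltrD2r.
case: ifPn => [_|_]; last by rewrite mule0.
rewrite -!EFinB -EFinM; congr (_%:E).
have : a != 0%R by rewrite gt_eqF.
by move=> ?; field.
Qed.

Lemma measurable_homothety (R : realType) (n : nat) (a : R) (b : Rn R n) :
  measurable_fun [set: Rn R n] (homothety a b).
Proof.
apply/measurable_fun_tnthP => i.
rewrite (_ : _ \o _ = fun y => a * tnth y i + tnth b i)%R; last first.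
  by apply/funext => y /=; rewrite tnth_mktuple.
apply: (measurableT_comp (measurable_affine a (tnth b i))).
exact: measurable_tnth.
Qed.

(** A homothety acts coordinatewise, so after splitting off the first coordinate it is a product map
    [h]. By induction, [a ^+ n.+1] times the pushforward under [h] has the right values on
    rectangles, and the product measure is unique. *)
Lemma lebesgue_Rn_homothety (R : realType) (n : nat) (a : R) (b : Rn R n)
    (A : set (Rn R n)) : (0 < a)%R -> measurable A ->
  lebesgue_Rn R n (homothety a b @^-1` A) = (a^-1 ^+ n)%:E * lebesgue_Rn R n A.
Proof.
move=> a0; elim: n b A => [|n IH] b A mA.
  rewrite expr0 mul1e /= !diracE; congr (_%:R%:E).
  by congr nat_of_bool; apply/idP/idP; rewrite !inE /= [homothety _ _ _]tuple0.
have [b0 [b' bE]] : exists (b0 : R) (b' : Rn R n), b = [tuple of b0 :: b'].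
  exists (thead b), [tuple of behead b].
  by rewrite [LHS]tuple_eta.
pose h (z : measurableTypeR R * Rn R n) : measurableTypeR R * Rn R n :=
  ((a * z.1 + b0)%R, homothety a b' z.2).
have mh : measurable_fun setT h.
  apply: measurable_fun_pair.
    exact: (measurableT_comp (measurable_affine a b0)).
  exact: (measurableT_comp (measurable_homothety a b')).
have hE z : homothety a b (Rn_cons z) = Rn_cons (h z).
  rewrite bE; apply: eq_from_tnth => i; rewrite tnth_mktuple.
  by case: (unliftP ord0 i) => [j ->|->]; rewrite ?tnthS ?tnth_mktuple// !tnth0.
rewrite /= /lebesgue_cons /pushforward.
rewrite (_ : _ @^-1` _ = h @^-1` (@Rn_cons R n @^-1` A)); last first.
  by apply/seteqP; split => z /=; rewrite hE.
have mB : measurable (@Rn_cons R n @^-1` A).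
  by rewrite -[X in measurable X]setTI; exact: measurable_Rn_cons.
move: (_ @^-1` A) mB => B mB.
have an0 : (0 <= a ^+ n.+1)%R by rewrite exprn_ge0// ltW.
pose m' := mscale (NngNum an0)
  (pushforward (@lebesgue_measure R \x lebesgue_Rn R n) h).
suff -> : (@lebesgue_measure R \x lebesgue_Rn R n) B = m' mh B.
  rewrite /m' /mscale /= /pushforward muleA -EFinM exprVn mulVf ?mul1e//.
  by rewrite gt_eqF// exprn_gt0.
apply: product_measure_unique => // C D mC mD.
rewrite /m' /= /mscale /= /pushforward.
rewrite (_ : _ @^-1` _ = ((fun x : R => a * x + b0)%R @^-1` C) `*`
   (homothety a b' @^-1` D)); last by apply/seteqP; split.
rewrite product_measure1E//; last 2 first.
- rewrite -[X in measurable X]setTI.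
  by apply: (measurable_affine a b0).
- by rewrite -[X in measurable X]setTI; exact: measurable_homothety.
rewrite [X in _ * (X * _)](lebesgue_measure_affine b0 a0 mC) IH//.
rewrite muleACA -EFinM -exprS exprVn.
by rewrite [LHS]muleA -EFinM mulfV ?mul1e// gt_eqF// exprn_gt0.
Qed.

(** * Algebra of the two homotheties of the lens *)

(* For the piece near [x], with [t = r / |x|]: the middle term is the largest
   [d] for which its image under [y |-> (y - x) / s + (1 + d) x], once in
   [B(x, r)], is also in [B(0, |x|)]. *)
Definition lens_shift (R : realType) (s t : R) : R :=
  (1 + ((1 - s ^+ 4 + t ^+ 2) / s - t ^+ 2) / 2 - s^-1)%R.

Section geometry.
Local Open Scope ring_scope.
Variable R : realType.

(** Here [rho], [N], [D] stand for [|x|], [|y|^2], [y.x], and the map is [z = y / s + (1 - s) x]. It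
    sends [B(0, s^2 rho)] to the ball of radius [s rho] about [(1 - s) x], internally tangent to
    [B(0, rho)] at [x]. Moreover [|z - x|^2 = N / s^2 - 2 D + s^2 rho^2], which the bounds on [N]
    and [D] push below [r^2 - rho^2 (1 - s^2)^2]. *)
Lemma lens_homothety_far (rho s r N D : R) : 0 < rho -> 0 < s < 1 ->
  N < (s ^+ 2 * rho) ^+ 2 ->
  0 <= N - 2 * s ^+ 2 * D + s ^+ 4 * rho ^+ 2 ->
  rho ^+ 2 + (s ^+ 2 * rho) ^+ 2 - r ^+ 2 <= 2 * D ->
  s^-1 ^+ 2 * N + 2 * s^-1 * (1 - s) * D + (1 - s) ^+ 2 * rho ^+ 2 < rho ^+ 2
  /\ s^-1 ^+ 2 * N + 2 * s^-1 * (1 - s - 1) * D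
     + (1 - s - 1) ^+ 2 * rho ^+ 2 < r ^+ 2.
Proof.
move=> rho0 /andP[s0 s1] Ns CS Dt.
have sn0 : s != 0 by rewrite gt_eqF.
have s2 : 0 < s ^+ 2 by rewrite exprn_gt0.
split; rewrite -subr_lt0.
  rewrite (_ : _ - _ = s^-1 ^+ 2 *
    (N + s * (1 - s) * (2 * D) - s ^+ 2 * (1 - (1 - s) ^+ 2) * rho ^+ 2));
    last by field.
  rewrite pmulr_rlt0 ?exprn_gt0 ?invr_gt0//.
  have : s * (s * (1 - s) * (2 * D)) <= (1 - s) * (N + s ^+ 4 * rho ^+ 2).
    by nra.
  have : s * (N + s * (1 - s) * (2 * D)
              - s ^+ 2 * (1 - (1 - s) ^+ 2) * rho ^+ 2)
     = s * N + s * (s * (1 - s) * (2 * D))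
       - s * (s ^+ 2 * (1 - (1 - s) ^+ 2) * rho ^+ 2) by ring.
  rewrite -(pmulr_rlt0 _ s0) => -> h.
  suff : N - s ^+ 4 * rho ^+ 2 < 0 by nra.
  by rewrite subr_lt0; move: Ns; rewrite exprMn -exprM.
rewrite (_ : _ - _ = s^-1 ^+ 2 * (N - s ^+ 4 * rho ^+ 2)
   + (2 * s ^+ 2 * rho ^+ 2 - 2 * D - r ^+ 2)); last by field.
have : s^-1 ^+ 2 * (N - s ^+ 4 * rho ^+ 2) < 0.
  rewrite pmulr_rlt0 ?exprn_gt0 ?invr_gt0// subr_lt0.
  by move: Ns; rewrite exprMn -exprM.
have := sqr_ge0 (rho * (1 - s ^+ 2)).
by nra.
Qed.

(** On this side of the radical hyperplane [2 (y - x).x <= - k rho^2]. Since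
    [z - x = (y - x) / s + d x], expanding [|z - x|^2] leaves the quadratic inequality [key] in [d],
    and [|z|^2 = |z - x|^2 + 2 (z - x).x + rho^2] gives the other bound. *)
Lemma lens_homothety_near (rho s t N D : R) : 0 < rho -> 0 < s < 1 -> 0 < t ->
  N - 2 * D + rho ^+ 2 < (t * rho) ^+ 2 ->
  2 * D <= rho ^+ 2 + (s ^+ 2 * rho) ^+ 2 - (t * rho) ^+ 2 ->
  let b := lens_shift s t in
  s^-1 ^+ 2 * N + 2 * s^-1 * b * D + b ^+ 2 * rho ^+ 2 < rho ^+ 2
  /\ s^-1 ^+ 2 * N + 2 * s^-1 * (b - 1) * D
     + (b - 1) ^+ 2 * rho ^+ 2 < (t * rho) ^+ 2.
Proof.
move=> rho0 /andP[s0 s1] t0 Et Dt.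
have sn0 : s != 0 by rewrite gt_eqF.
pose k := 1 - s ^+ 4 + t ^+ 2; pose d := (k / s - t ^+ 2) / 2.
have k0 : t ^+ 2 < k.
  by rewrite /k ltrDr subr_gt0 exprn_ilt1// ltW.
have t20 : 0 < t ^+ 2 by rewrite exprn_gt0.
have d0 : 0 < d.
  rewrite divr_gt0// subr_gt0 ltr_pdivlMr// (le_lt_trans _ k0)//.
  by rewrite ler_piMr// ltW.
(* By the choice of [d], the right-hand side is [(k^2 / s^2 - t^4) / 4]; the difference then factors
   as [1 - s^2] times a sum of nonnegative terms. *)
have key : (s^-1 ^+ 2 - 1) * t ^+ 2 <= d * (k / s - d).
  rewrite -subr_ge0 (_ : _ - _ = s^-1 ^+ 2 / 4 *
     (k ^+ 2 - s ^+ 2 * t ^+ 4 - 4 * (1 - s ^+ 2) * t ^+ 2)); last first.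
    by rewrite /d; field.
  rewrite mulr_ge0 ?divr_ge0 ?exprn_ge0 ?invr_ge0 ?(ltW s0)//.
  rewrite (_ : _ - _ = (1 - s ^+ 2) * ((t ^+ 2 - (1 - s ^+ 2)) ^+ 2
     + (1 - s ^+ 2) * (3 * s ^+ 2 + s ^+ 4))); last by rewrite /k; ring.
  have : 0 <= 1 - s ^+ 2 by rewrite subr_ge0 exprn_ile1 ?ltW.
  move=> h; rewrite mulr_ge0// addr_ge0 ?sqr_ge0// mulr_ge0//.
  by rewrite addr_ge0 ?mulr_ge0 ?exprn_ge0 ?ltW.
have bE : lens_shift s t = 1 + d - s^-1 by [].
rewrite /= bE.
have V : 2 * (D - rho ^+ 2) <= - k * rho ^+ 2.
  by rewrite /k; nra.
have near : s^-1 ^+ 2 * N + 2 * s^-1 * (1 + d - s^-1 - 1) * D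
     + (1 + d - s^-1 - 1) ^+ 2 * rho ^+ 2 < (t * rho) ^+ 2.
  rewrite (_ : _ + _ = s^-1 ^+ 2 * (N - 2 * D + rho ^+ 2)
     + d / s * (2 * (D - rho ^+ 2)) + d ^+ 2 * rho ^+ 2); last by field.
  apply: (@lt_le_trans _ _ (s^-1 ^+ 2 * (t * rho) ^+ 2
      + d / s * (- k * rho ^+ 2) + d ^+ 2 * rho ^+ 2)).
    rewrite ltrD2r ltr_leD// ?ltr_pM2l ?exprn_gt0 ?invr_gt0//.
    by rewrite ler_pM2l// divr_gt0.
  rewrite -subr_le0 (_ : _ - _ = rho ^+ 2 *
     ((s^-1 ^+ 2 - 1) * t ^+ 2 - d * (k / s - d))); last by field.
  by rewrite mulr_ge0_le0 ?sqr_ge0// subr_le0.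
split => //.
rewrite (_ : _ + _ = s^-1 ^+ 2 * N + 2 * s^-1 * (1 + d - s^-1 - 1) * D
     + (1 + d - s^-1 - 1) ^+ 2 * rho ^+ 2
     + s^-1 * (2 * (D - rho ^+ 2)) + (1 + 2 * d) * rho ^+ 2); last by field.
apply: (@lt_le_trans _ _ ((t * rho) ^+ 2 + s^-1 * (- k * rho ^+ 2)
   + (1 + 2 * d) * rho ^+ 2)).
  by rewrite ltrD2r ltr_leD// ler_pM2l// invr_gt0.
(* Equality holds: [d] solves [t^2 - k / s + 1 + 2 d = 1]. *)
by rewrite le_eqVlt; apply/orP; left; apply/eqP; rewrite /d; field.
Qed.

End geometry.

(** * Balls in coordinates, the lens estimate and volumes of balls *)

Section balls.
Variables (R : realType) (n : nat).
Local Open Scope ring_scope.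
Implicit Types (x y : Rn R n) (a b r s : R).

Definition dotp x y : R := \sum_(i < n) (tnth x i : R) * tnth y i.

Lemma dotp_enorm x : dotp x x = enorm x ^+ 2.
Proof. by rewrite sqr_sqrtr ?sumr_ge0// => i _; rewrite ?sqr_ge0. Qed.

Lemma enorm_ge0 x : 0 <= enorm x.
Proof. exact: sqrtr_ge0. Qed.

Lemma sum_sqr_lin x y a b :
  \sum_(i < n) (a * (tnth y i : R) + b * tnth x i) ^+ 2
  = a ^+ 2 * dotp y y + 2 * a * b * dotp y x + b ^+ 2 * dotp x x.
Proof.
rewrite /dotp !mulr_sumr -!big_split/=; apply: eq_bigr => i _; ring.
Qed.

Lemma sqrtr_lt a r : 0 < r -> (Num.sqrt a < r) = (a < r ^+ 2).
Proof.
move=> r0; rewrite -[X in _ < X](ger0_norm (ltW r0)) -sqrtr_sqr.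
by rewrite ltr_sqrt// exprn_gt0.
Qed.

Lemma in_eball x r y : 0 < r ->
  eball x r y <-> dotp y y - 2 * dotp y x + dotp x x < r ^+ 2.
Proof.
move=> r0; rewrite /eball/= /enorm sqrtr_lt//.
rewrite (eq_bigr (fun i => (1 * (tnth y i : R) + -1 * tnth x i) ^+ 2)).
  rewrite sum_sqr_lin; set u := (X in X < _); set v := (X in _ <-> X < _).
  by rewrite (_ : u = v)// /u /v; ring.
by move=> i _; rewrite tnth_mktuple mul1r mulN1r.
Qed.

Lemma in_eball0 r y : eball (Rn_origin R n) r y <-> enorm y < r.
Proof.
rewrite /eball/= (_ : [tuple _ | i < n] = y)//.
by apply: eq_from_tnth => i; rewrite !tnth_mktuple subr0.
Qed.

Lemma in_eball0_sqr r y : 0 < r ->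
  eball (Rn_origin R n) r y <-> dotp y y < r ^+ 2.
Proof.
by move=> r0; rewrite in_eball0 dotp_enorm ltr_pXn2r// nnegrE ?enorm_ge0 ?ltW.
Qed.

Definition scale_tuple b x : Rn R n := [tuple b * tnth x i | i < n].

Lemma dotp_homothety a b x y :
  let z := homothety a (scale_tuple b x) y in
  dotp z z = a ^+ 2 * dotp y y + 2 * a * b * dotp y x + b ^+ 2 * dotp x x.
Proof.
rewrite -sum_sqr_lin; apply: eq_bigr => i _.
by rewrite !tnth_mktuple expr2.
Qed.

Lemma in_eball_homothety a b x y r : 0 < r ->
  eball x r (homothety a (scale_tuple b x) y) <->
  a ^+ 2 * dotp y y + 2 * a * (b - 1) * dotp y x + (b - 1) ^+ 2 * dotp x x
    < r ^+ 2.
Proof.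
move=> r0; rewrite /eball/= /enorm sqrtr_lt// -sum_sqr_lin.
rewrite (eq_bigr (fun i => (a * (tnth y i : R) + (b - 1) * tnth x i) ^+ 2))//.
by move=> i _; rewrite !tnth_mktuple; ring.
Qed.

(** On the side of the radical hyperplane towards [x] the small lens is a cap of [B(0, s^2 |x|)]; on
    the other side it is a cap of [B(x, r)]. Each cap has its own homothety. *)
Lemma lens_subset x r s : 0 < enorm x -> 0 < r -> 0 < s < 1 ->
  let L := eball x r `&` eball (Rn_origin R n) (enorm x) in
  eball x r `&` eball (Rn_origin R n) (s ^+ 2 * enorm x) `<=`
  homothety s^-1 (scale_tuple (1 - s) x) @^-1` L `|`
  homothety s^-1 (scale_tuple (lens_shift s (r / enorm x)) x) @^-1` L.
Proof.
move=> x0 r0 s01 L y; have /andP[s0 s1] := s01.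
rewrite /setI/setU/preimage/L/=.
rewrite !in_eball0_sqr ?mulr_gt0 ?exprn_gt0//.
rewrite !in_eball_homothety// in_eball// !dotp_homothety.
(* [|y - s^2 x|^2 >= 0] plays the role of Cauchy-Schwarz. *)
move=> [h1 h2]; have := @sum_sqr_lin x y 1 (- s ^+ 2).
have : 0 <= \sum_(i < n) (1 * (tnth y i : R) + - s ^+ 2 * tnth x i) ^+ 2.
  by apply: sumr_ge0 => i _; rewrite sqr_ge0.
move=> /[swap] -> CS.
rewrite (dotp_enorm x) in h1 CS *.
(* Equality here is the radical hyperplane, where [|y - x|^2 - r^2 = |y|^2 - (s^2 |x|)^2]. *)
have [h|h] := leP (enorm x ^+ 2 + (s ^+ 2 * enorm x) ^+ 2 - r ^+ 2)
                  (2 * dotp y x).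
  left; have [|hA hB] := lens_homothety_far x0 s01 h2 _ h; last by split.
  by apply: le_trans CS _; rewrite le_eqVlt; apply/orP; left;
     apply/eqP; ring.
right; set t := r / enorm x.
have rE : r = t * enorm x by rewrite divfK// gt_eqF.
have t0 : 0 < t by rewrite divr_gt0.
have [] := @lens_homothety_near _ (enorm x) s t (dotp y y) (dotp y x) x0 s01 t0.
- by rewrite -rE.
- by rewrite -rE ltW.
by rewrite -rE => hA hB; split.
Qed.

(** Each of the two preimages has [s^n] times the volume of the large lens, because the ratio is
    [1 / s]; the factor 2 counts them. *)
Lemma lens_volume x r s : 0 < enorm x -> 0 < r -> 0 < s < 1 ->
  (lebesgue_Rn R n (eball x r `&` eball (Rn_origin R n) (s ^+ 2 * enorm x))
  <= (2 * s ^+ n)%:E *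
     lebesgue_Rn R n (eball x r `&` eball (Rn_origin R n) (enorm x)))%E.
Proof.
move=> x0 r0 s01; have /andP[s0 s1] := s01.
have mL : measurable (eball x r `&` eball (Rn_origin R n) (enorm x)).
  by apply: measurableI; exact: measurable_eball.
apply: le_trans (lebesgue_Rn_monotone (lens_subset x0 r0 s01)) _.
have mh (b : Rn R n) : measurable (homothety s^-1 b @^-1`
    (eball x r `&` eball (Rn_origin R n) (enorm x))).
  by rewrite -[X in measurable X]setTI; exact: measurable_homothety.
have hE (b : Rn R n) : lebesgue_Rn R n (homothety s^-1 b @^-1`
    (eball x r `&` eball (Rn_origin R n) (enorm x))) = ((s ^+ n)%:E *
     lebesgue_Rn R n (eball x r `&` eball (Rn_origin R n) (enorm x)))%E.
  by rewrite lebesgue_Rn_homothety ?invr_gt0// invrK.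
rewrite mulrDl mul1r EFinD ge0_muleDl ?lee_fin ?exprn_ge0 ?(ltW s0)//.
rewrite -{1}(hE (scale_tuple (1 - s) x)).
rewrite -(hE (scale_tuple (lens_shift s (r / enorm x)) x)).
by apply: measureU2; exact: mh.
Qed.

Lemma volume_eball0 r : 0 < r ->
  (lebesgue_Rn R n (eball (Rn_origin R n) r)
  = (r ^+ n)%:E * lebesgue_Rn R n (eball (Rn_origin R n) 1))%E.
Proof.
move=> r0; rewrite -{2}[r]invrK -(lebesgue_Rn_homothety (Rn_origin R n)).
- congr (lebesgue_Rn R n _); apply/seteqP.
  have h y : eball (Rn_origin R n) 1 (homothety r^-1 (Rn_origin R n) y) <->
     eball (Rn_origin R n) r y.
    rewrite {2}(_ : Rn_origin R n = scale_tuple 0 y); last first.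
      by apply: eq_from_tnth => i; rewrite !tnth_mktuple mul0r.
    rewrite !in_eball0_sqr// dotp_homothety.
    rewrite !(mulr0, mul0r, expr0n, addr0) expr1n exprVn mulrC ltr_pdivrMr//.
      by rewrite mul1r.
    by rewrite exprn_gt0.
  by split => y /h.
- by rewrite invr_gt0.
- exact: measurable_eball.
Qed.

Lemma volume_unit_ball_fin :
  (lebesgue_Rn R n (eball (Rn_origin R n) 1) < +oo)%E.
Proof.
pose A (i : 'I_n) : set (measurableTypeR R) := `[-1, 1]%classic.
apply: (@le_lt_trans _ _ (lebesgue_Rn R n [set x | forall i, A i (tnth x i)])).
  apply: lebesgue_Rn_monotone => y; rewrite in_eball0_sqr// expr1n => y1 i /=.
  rewrite /A/= in_itv/= -ler_norml -(@ler_pXn2r _ 2)// ?nnegrE// expr1n.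
  rewrite real_normK ?num_real// (le_trans _ (ltW y1))//.
  rewrite /dotp (bigD1 i)//= -expr2 lerDl sumr_ge0// => j _.
  by rewrite -expr2 sqr_ge0.
rewrite lebesgue_Rn_box; last by move=> i; exact: measurable_itv.
rewrite -ge0_fin_numE; last by apply: prode_ge0 => i _; exact: measure_ge0.
by apply: prode_fin_num => i _; rewrite /= lebesgue_measure_itv/= ; case: ifP.
Qed.

Lemma volume_unit_ball_gt0 : (0 < n)%N ->
  (0 < lebesgue_Rn R n (eball (Rn_origin R n) 1))%E.
Proof.
move=> n0.
have nR : 0 < n%:R :> R by rewrite ltr0n.
(* A cube inside the unit ball: its points satisfy [y_i^2 <= y_i / n] and [y_i < 1], so
   [|y|^2 < 1]. *)
pose A (i : 'I_n) : set (measurableTypeR R) := `]0, n%:R^-1[%classic.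
apply: (@lt_le_trans _ _ (lebesgue_Rn R n [set x | forall i, A i (tnth x i)])).
  rewrite lebesgue_Rn_box; last by move=> i; exact: measurable_itv.
  rewrite (eq_bigr (fun=> (n%:R^-1)%:E)); last first.
    move=> i _; rewrite /= lebesgue_measure_itv/= lte_fin invr_gt0 nR.
    by rewrite oppr0 adde0.
  by rewrite prodEFin lte_fin prodr_gt0// => i _; rewrite invr_gt0.
apply: lebesgue_Rn_monotone => y /= h; rewrite in_eball0_sqr// expr1n.
apply: (@le_lt_trans _ _ (\sum_(i < n) (n%:R^-1 * tnth y i))).
  apply: ler_sum => i _; have := h i; rewrite /A/= in_itv/= => /andP[y0 y1].
  by rewrite ler_pM2r// ltW.
apply: (@lt_le_trans _ _ (\sum_(i < n) n%:R^-1)).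
  apply: ltr_sum.
    by apply/hasP; exists (Ordinal n0) => //; rewrite mem_index_enum.
  move=> i _; have := h i; rewrite /A/= in_itv/= => /andP[y0 y1].
  rewrite -[ltRHS]mulr1 ltr_pM2l ?invr_gt0//.
  by rewrite (lt_le_trans y1)// invf_le1// ler1n.
by rewrite sumr_const card_ord -[X in X <= _]mulr_natl mulfV// gt_eqF.
Qed.

End balls.

(** * Finiteness of the measure and measurability of the norm *)

Lemma nu_fin (R : realType) (n : nat) : fin_num_fun (nu R n).
Proof.
move=> A mA; rewrite ge0_fin_numE//.
apply: le_lt_trans (volume_unit_ball_fin R n).
by apply: lebesgue_Rn_monotone; exact: subIsetr.
Qed.

(* [nu R n] is a bundled measure; a bare set function is needed to attach the
   finiteness instance used by Tonelli's theorem. *)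
Definition nu_fun (R : realType) (n : nat) : set (Rn R n) -> \bar R := nu R n.

HB.instance Definition _ (R : realType) (n : nat) :=
  isMeasure.Build _ _ _ (@nu_fun R n) (measure0 (nu R n))
    (measure_ge0 (nu R n)) (@measure_semi_sigma_additive _ _ _ (nu R n)).

HB.instance Definition _ (R : realType) (n : nat) :=
  @Measure_isFinite.Build _ _ R (@nu_fun R n) (@nu_fin R n).

Lemma measurable_enorm (R : realType) (n : nat) :
  measurable_fun [set: Rn R n] (@enorm R n).
Proof.
apply: (measurableT_comp (f := @Num.sqrt R)).
  by apply: continuous_measurable_fun; exact: sqrt_continuous.
apply: measurable_sum => i; apply: measurable_funX.
exact: measurable_tnth.
Qed.

(** * Tail integral of a power *)

Lemma powR_cvgy0 (R : realType) (b : R) : (0 < b)%R ->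
  (x `^ (- b) @[x --> +oo%R] --> (0 : R))%R.
Proof.
move=> b0; apply/cvgr0Pnorm_lt => e e0; near=> x.
have x0 : (0 < x)%R by near: x; exact: nbhs_pinfty_gt.
rewrite ger0_norm ?powR_ge0// powRN invf_plt ?posrE ?powR_gt0//.
have -> : (e^-1 = (e^-1 `^ b^-1) `^ b)%R.
  by rewrite -powRrM mulVf ?gt_eqF// powRr1// invr_ge0 ltW.
apply: gt0_ltr_powR; rewrite ?nnegrE ?powR_ge0 ?(ltW x0)//.
Unshelve. all: by end_near. Qed.

Lemma integral_powR_tail (R : realType) (k a : R) : (0 < k)%R -> (1 < a)%R ->
  \int[lebesgue_measure]_(l in `[k, +oo[) ((k `^ a * l `^ (- a))%R)%:E
  = (k / (a - 1))%:E.
Proof.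
move=> k0 a1; have a0 : (a - 1 != 0)%R by rewrite gt_eqF// subr_gt0.
(* The antiderivative that vanishes at infinity, so the integral is [- F k]. *)
pose F (l : R) := (- (k `^ a / (a - 1)) * l `^ (- (a - 1)))%R.
have dF (l : R) : (0 < l)%R -> is_derive l 1%R F (k `^ a * l `^ (- a))%R.
  move=> l0; rewrite /F.
  have := is_derive1_powR (- (a - 1))%R l0 => h.
  apply: is_derive_eq.
  rewrite /GRing.scale/= (_ : - (a - 1) - 1 = - a)%R; last by ring.
  by field.
have cF (l : R) : (0 < l)%R -> {for l, continuous F}.
  move=> l0; apply/differentiable_continuous/derivable1_diffP.
  by have [] := dF _ l0.
have cf (l : R) : (0 < l)%R ->
    {for l, continuous (fun l => k `^ a * l `^ (- a))%R}.
  move=> l0; apply: cvgM; first exact: cvg_cst.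
  have : derivable (@powR R ^~ (- a)%R) l 1%R.
    by have [] := is_derive1_powR (- a)%R l0.
  by move=> /derivable1_diffP/differentiable_continuous.
have f0 (x : R) : (k <= x)%R -> (0 <= k `^ a * x `^ (- a))%R.
  by move=> _; rewrite mulr_ge0// powR_ge0.
have cfk : {within `[k, +oo[, continuous (fun l => k `^ a * l `^ (- a))%R}.
  apply/continuous_within_itvcyP; split; last first.
    exact: cvg_at_right_filter (cf _ k0).
  by move=> x; rewrite in_itv/= andbT => kx; exact: cf (lt_trans k0 kx).
have Foo : (F x @[x --> +oo] --> 0)%R.
  rewrite -[X in _ --> X](mulr0 (- (k `^ a / (a - 1)))%R).
  by apply: cvgM; [exact: cvg_cst|apply: powR_cvgy0; rewrite subr_gt0].
have dF1 (x : R) : (k < x)%R -> derivable F x 1%R.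
  by move=> kx; have [] := dF x (lt_trans k0 kx).
have Fk : (F x @[x --> k^'+] --> F k)%R.
  by apply: cvg_at_right_filter; exact: cF.
have dF2 : {in `]k, +oo[%R, F^`()%classic =1 (fun l => k `^ a * l `^ (- a))%R}.
  move=> x; rewrite in_itv/= andbT => kx.
  by rewrite derive1E; have [_ ->] := dF x (lt_trans k0 kx).
have FTC := @ge0_continuous_FTC2y R (fun l => k `^ a * l `^ (- a))%R F k 0%R.
have {}FTC := FTC f0 cfk Foo dF1 Fk dF2.
rewrite FTC /F sub0e -EFinN; congr (_%:E); rewrite mulNr opprK mulrAC -powRD.
  by rewrite (_ : a - _ = 1)%R ?powRr1 ?ltW//; ring.
by apply/implyP => _; rewrite gt_eqF.
Qed.

(** * Averages over balls by the layer-cake formula *)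

(** For [l > k] the level set of [g] lies in [B(0, q^2 |x|)] with [q = (k / l)^(p / (2 n))]. By
    [lens_volume] it fills at most [2 q^n = 2 (k / l)^(p / 2)] of [nu R n (eball x r)]; integrating
    over [l] gives the bound. *)
Lemma average_le (R : realType) (n : nat) (x : Rn R n) (r k p : R)
    (g : Rn R n -> \bar R) :
  (0 < n)%N -> (0 < enorm x <= 1)%R -> (0 < r)%R -> (0 < k)%R -> (2 < p)%R ->
  (forall y, 0 <= g y) ->
  (forall y (l : R), (k < l)%R -> l%:E < g y ->
    (enorm y < (k `^ (p / 2 / n%:R) * l `^ (- (p / 2 / n%:R))) ^+ 2
               * enorm x)%R) ->
  \int[nu R n]_(y in eball x r) g y
  <= ((p + 2) / (p - 2) * k)%:E * nu R n (eball x r).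
Proof.
move=> n0 /andP[x0 x1] r0 k0 p2 g0 gk.
have nR : (n%:R != 0 :> R)%R by rewrite pnatr_eq0 -lt0n.
pose a := (p / 2)%R; pose b := (a / n%:R)%R.
have b0 : (0 < b)%R by rewrite !divr_gt0 ?ltr0n//; lra.
pose D := eball x r.
have mD : measurable D by exact: measurable_eball.
pose q (l : R) := (k `^ b * l `^ (- b))%R.
have qn l : (q l ^+ n = k `^ a * l `^ (- a))%R.
  rewrite /q exprMn -!powR_mulrn ?powR_ge0// -!powRrM mulNr.
  by rewrite /b divfK.
have q01 l : (k < l)%R -> (0 < q l < 1)%R.
  move=> kl; have l0 := lt_trans k0 kl.
  rewrite /q mulr_gt0 ?powR_gt0//= powRN ltr_pdivrMr ?powR_gt0// mul1r.
  by apply: gt0_ltr_powR; rewrite ?nnegrE ?ltW.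
(* An explicit measurable set containing the part of the region below the graph of [g] over [D] with
   height above [k]. Tonelli's theorem is applied to it rather than to that region. *)
pose A : set (measurableTypeR R * Rn R n) :=
  [set z | (k < z.1)%R /\ D z.2 /\ (enorm z.2 < q z.1 ^+ 2 * enorm x)%R].
have mA : measurable A.
  rewrite (_ : A = (fun z => k < z.1)%R @^-1` [set true] `&`
    (snd @^-1` D `&`
     (fun z => enorm z.2 < q z.1 ^+ 2 * enorm x)%R @^-1` [set true])).
    apply: measurableI; last apply: measurableI.
    - have : measurable_fun [set: measurableTypeR R * Rn R n]
          (fun z => k < z.1)%R.
        by apply: measurable_fun_ltr => //; exact: measurable_fst.
      by move=> /(_ measurableT [set true]); rewrite setTI; exact.
    - by rewrite -[X in measurable X]setTI; exact: measurable_snd.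
    - have : measurable_fun [set: measurableTypeR R * Rn R n]
          (fun z => enorm z.2 < q z.1 ^+ 2 * enorm x)%R.
        apply: measurable_fun_ltr.
          apply: (measurableT_comp (@measurable_enorm R n)).
          exact: measurable_snd.
        apply: measurable_funM => //; apply: measurable_funX.
        apply: measurable_funM => //.
        apply: (measurableT_comp (measurable_powR (- b)%R)).
        exact: measurable_fst.
      by move=> /(_ measurableT [set true]); rewrite setTI; exact.
  by apply/seteqP; split => z.
have tonelli : \int[nu R n]_y lebesgue_measure (ysection A y)
    = \int[lebesgue_measure]_l nu R n (xsection A l).
  have := @indic_fubini_tonelli _ _ _ _ R
    (@lebesgue_measure R) (@nu_fun R n) A mA.
  by rewrite indic_fubini_tonelli_FE// indic_fubini_tonelli_GE// => /esym.
have mys : measurable_fun [set: Rn R n]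
    (fun y => lebesgue_measure (ysection A y)).
  exact: (measurable_fun_ysection (@lebesgue_measure R)).
have gle y : D y -> g y <= k%:E + lebesgue_measure (ysection A y).
  (* Real minorants [c] of [g y] are treated first, to cover [g y = +oo]: the section of [A]
     contains []k, c[]. *)
  move=> Dy; have h (c : R) : c%:E <= g y ->
      c%:E <= k%:E + lebesgue_measure (ysection A y).
    move=> cg; have [ck|kc] := leP c k.
      by apply: (@le_trans _ _ k%:E); rewrite ?lee_fin// leeDl.
    apply: (@le_trans _ _ (k%:E + lebesgue_measure (`]k, c[%classic : set R))).
      rewrite lebesgue_measure_itv/= lte_fin kc -EFinB -EFinD lee_fin.
      by rewrite addrC subrK.
    rewrite leeD2l// le_measure ?inE//; first exact: measurable_ysection.
    move=> l /=; rewrite in_itv/= => /andP[kl lc].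
    rewrite /ysection/= inE /A/=; split => //; split => //.
    by apply: gk => //; apply: lt_le_trans cg; rewrite lte_fin.
  have := g0 y; case gy : (g y) h => [c| |] h // _; first by apply: h.
  rewrite leye_eq; apply/eqP/eqyP => B B0; apply: h; exact: leey.
have nuD : nu R n D \is a fin_num by apply: nu_fin.
apply: (@le_trans _ _ (\int[nu R n]_(y in D)
   (k%:E + lebesgue_measure (ysection A y)))).
  by apply: ge0_le_integral_nonmeas => y Dy //; exact: gle.
rewrite ge0_integralD//; last 2 first.
- by move=> y _; rewrite lee_fin ltW.
- exact: measurable_funTS.
rewrite integral_cst//.
(* The term [k] comes from the levels below [k], the other from twice the tail integral with
   exponent [a = p / 2]. *)
have -> : ((p + 2) / (p - 2) * k = k + 2 * (k / (a - 1)))%R.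
  have p20 : (p - 2 != 0)%R by rewrite gt_eqF// subr_gt0.
  by rewrite /a; field; rewrite p20.
have a1 : (1 < a)%R by rewrite /a; lra.
rewrite EFinD ge0_muleDl ?lee_fin ?(ltW k0)//; last first.
  by rewrite mulr_ge0// divr_ge0 ?ltW// subr_gt0.
rewrite leeD2l//.
apply: (@le_trans _ _ (\int[nu R n]_y lebesgue_measure (ysection A y))).
  exact: ge0_subset_integral.
rewrite tonelli.
apply: (@le_trans _ _ (\int[lebesgue_measure]_(l in `]k, +oo[)
   ((k `^ a * l `^ (- a))%:E * (2%:E * nu R n D)))).
  rewrite [leRHS]integral_mkcond; apply: ge0_le_integral_nonmeas => // l _.
  rewrite patchE; case: ifPn => [/set_mem/=|/negP kl].
    rewrite in_itv/= andbT => kl.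
    rewrite muleA -EFinM mulrC -qn.
    apply: (@le_trans _ _ (lebesgue_Rn R n
       (eball x r `&` eball (Rn_origin R n) (q l ^+ 2 * enorm x)))).
      apply: lebesgue_Rn_monotone => y [].
      rewrite /xsection/= inE /A/= => -[_ [Dy ys]] _; split => //.
      exact/in_eball0.
    apply: le_trans (lens_volume x0 r0 (q01 _ kl)) _.
    rewrite lee_pmul2l// ?lte_fin ?mulr_gt0 ?exprn_gt0 ?(andP (q01 _ kl)).1//.
    (* Since [|x| <= 1], the large lens lies in the part of [D] seen by [nu R n]. *)
    apply: lebesgue_Rn_monotone => y [Dy /in_eball0 yx]; split => //.
    by apply/in_eball0; exact: lt_le_trans x1.
  rewrite (_ : xsection A l = set0) ?measure0//.
  apply/seteqP; split => // y; rewrite /xsection/= inE /A/= => -[kl' _].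
  by apply: kl; rewrite inE/= in_itv/= andbT.
apply: (@le_trans _ _ (\int[lebesgue_measure]_(l in `[k, +oo[)
   ((k `^ a * l `^ (- a))%:E * (2%:E * nu R n D)))).
  apply: ge0_subset_integral => //.
  - apply: emeasurable_funM => //; apply/measurable_EFinP.
    apply: measurable_funM => //.
    by apply: measurable_funTS; exact: measurable_powR.
  - by move=> l _; rewrite mule_ge0// ?lee_fin ?mulr_ge0 ?powR_ge0// mule_ge0.
  - by apply: subset_itvr; rewrite bnd_simp.
rewrite ge0_integralZr//; last 2 first.
- apply/measurable_EFinP.
  apply: measurable_funM => //; apply: measurable_funTS; exact: measurable_powR.
- by move=> l _; rewrite lee_fin mulr_ge0 ?powR_ge0.
by rewrite integral_powR_tail// muleA -EFinM mulrC.
Qed.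

(** * Integrals of essentially bounded functions *)

(** Adding [+oo] on a measurable null set turns [c] into a measurable bound valid everywhere, and
    the added term has integral 0. *)
Lemma ae_integral_le_cst d (T : measurableType d) (R : realType)
    (mu : {measure set T -> \bar R}) (D : set T) (f : T -> \bar R) (c : R) :
  measurable D -> (0 <= c)%R -> (\forall x \ae mu, `|f x| <= c%:E) ->
  \int[mu]_(x in D) `|f x| <= c%:E * mu D.
Proof.
move=> mD c0 [N [mN N0 fN]]; pose h := (cst +oo : T -> \bar R) \_ N.
have mh : measurable_fun D h.
  apply: measurable_funTS; apply/(measurable_restrictT _ mN).
  exact: measurable_cst.
have h0 x : 0 <= h x by rewrite /h patchE; case: ifP => _; rewrite /= ?leey.
apply: (@le_trans _ _ (\int[mu]_(x in D) (c%:E + h x))).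
  apply: ge0_le_integral_nonmeas => x _ //; rewrite /h patchE.
  case: ifPn => [_|/negP xN]; first by rewrite addey// leey.
  rewrite adde0; apply: contrapT => fx; apply: xN; rewrite inE; exact: fN.
rewrite ge0_integralD//.
rewrite integral_cst// -integral_mkcondr integral_cst; last exact: measurableI.
rewrite (_ : mu (D `&` N) = 0) ?mule0 ?adde0//.
apply/eqP; rewrite eq_le measure_ge0 andbT -N0 le_measure// inE//.
exact: measurableI.
Qed.

(** * Weak-type bounds for radial decreasing functions *)

Section maximal_radial.
Context (R : realType) (n : nat) (n0 : (0 < n)%N).
Variables (g0 : R -> \bar R) (g : Rn R n -> \bar R).
Hypothesis g0_ge0 : forall r, (0 <= r)%R -> 0 <= g0 r.
Hypothesis g0_fin : forall r, (0 < r)%R -> g0 r < +oo.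
Hypothesis g0_dec : forall r s, (0 <= r)%R -> (r <= s)%R -> g0 s <= g0 r.
Hypothesis gE : forall x, g x = g0 (enorm x).

Let B1 := eball (Rn_origin R n) 1.
Let w : R := fine (lebesgue_Rn R n B1).

Let g_ge0 y : 0 <= g y.
Proof. by rewrite gE g0_ge0// enorm_ge0. Qed.

Let wE : lebesgue_Rn R n B1 = w%:E.
Proof.
by rewrite fineK// ge0_fin_numE ?measure_ge0// volume_unit_ball_fin.
Qed.

Let w0 : (0 < w)%R.
Proof. by rewrite -lte_fin -wE volume_unit_ball_gt0. Qed.

Lemma nu_eball0 t : (0 < t)%R -> (t <= 1)%R ->
  nu R n (eball (Rn_origin R n) t) = (t ^+ n * w)%:E.
Proof.
move=> t0 t1; rewrite EFinM -wE -volume_eball0//.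
congr (lebesgue_Rn R n _); apply/setIidPl => y.
rewrite !in_eball0 => yt; exact: lt_le_trans t1.
Qed.

(** The radius 2 is admissible, so the supremum in [maximal] is not over the empty set. Indeed
    [B(x, 2)] contains the unit ball, as [|y - x|^2 <= 2 |x|^2 + 2 |y|^2 < 4]. *)
Lemma nu_eball_gt0 x : (enorm x < 1)%R -> 0 < nu R n (eball x 2).
Proof.
move=> x1; rewrite (@lt_le_trans _ _ (w%:E)) ?lte_fin// -wE.
apply: lebesgue_Rn_monotone => y y1; split => //; move: y1.
rewrite /B1 in_eball0 in_eball// !dotp_enorm => y1.
have := @sum_sqr_lin _ _ x y 1 1.
have : (0 <= \sum_(i < n) (1 * (tnth y i : R) + 1 * tnth x i) ^+ 2)%R.
  by apply: sumr_ge0 => i _; rewrite sqr_ge0.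
move=> /[swap] ->; rewrite !dotp_enorm !(expr1n, mul1r, mulr1) => h.
have : (enorm y ^+ 2 < 1)%R by rewrite exprn_ilt1// enorm_ge0.
have : (enorm x ^+ 2 < 1)%R by rewrite exprn_ilt1// enorm_ge0.
by move=> *; lra.
Qed.

Lemma maximal_ge0 x : (enorm x < 1)%R -> 0 <= maximal (nu R n) g x.
Proof.
move=> x1; have x2 := nu_eball_gt0 x1.
apply: (@le_trans _ _ ((nu R n (eball x 2))^-1 *
  \int[nu R n]_(y in eball x 2) `|g y|)).
  by rewrite mule_ge0 ?inve_ge0 ?measure_ge0// integral_ge0.
by apply: ereal_sup_ubound; exists 2%R.
Qed.

Lemma maximal_le x (c : R) : (0 <= c)%R ->
  (forall r, (0 < r)%R ->
    \int[nu R n]_(y in eball x r) `|g y| <= c%:E * nu R n (eball x r)) ->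
  maximal (nu R n) g x <= c%:E.
Proof.
move=> c0 h; apply/ereal_supP => _ [r [r0 nur] <-].
have nf : nu R n (eball x r) \is a fin_num.
  by apply: nu_fin; exact: measurable_eball.
have := h _ r0; rewrite -(fineK nf) in nur *.
move: nur; rewrite lte_fin => nur ih.
rewrite inver gt_eqF// muleC lee_pdivrMr//.
Qed.

Section finite_exponent.
Variables (p G : R) (p2 : (2 < p)%R) (G0 : (0 < G)%R).
Hypothesis gG : \int[nu R n]_x `|g x| `^ p <= (G `^ p)%:E.

Let p0 : (0 < p)%R. Proof. by apply: lt_trans p2. Qed.

Let C0 : (0 < (p + 2) / (p - 2))%R.
Proof. by move: p0 p2 => ? ?; apply: divr_gt0; lra. Qed.

(** Chebyshev's inequality on [B(0, t)], where [g >= g0 t >= c] by monotonicity. *)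
Lemma profile_le t (c : R) : (0 < t < 1)%R -> (0 <= c)%R -> c%:E <= g0 t ->
  (c `^ p * (t ^+ n * w) <= G `^ p)%R.
Proof.
move=> /andP[t0 t1] c0 ct; rewrite -lee_fin; apply: le_trans gG.
rewrite EFinM -nu_eball0 ?(ltW t1)//.
rewrite -integral_cst; last exact: measurable_eball.
rewrite integral_mkcond; apply: ge0_le_integral_nonmeas => y _.
  by rewrite patchE; case: ifP; rewrite ?lee_fin ?powR_ge0.
rewrite patchE; case: ifPn => [/set_mem/in_eball0 yt|_]; last exact: poweR_ge0.
rewrite gee0_abs// -poweR_EFin gt0_ler_poweR ?(ltW p0)//.
- by rewrite in_itv/= lee_fin c0 leey.
- by rewrite in_itv/= g_ge0 leey.
- by rewrite gE; apply: le_trans ct _; rewrite g0_dec ?enorm_ge0// ltW.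
Qed.

(** Here [k] is the bound of [profile_le] at radius [|x|]. At radius [t = q^2 |x|] that bound is
    [l], so a point with [|y| >= t] and [g y > l] would force [g0 t > l] and contradict
    [profile_le]. *)
Lemma maximal_le_profile x (k : R) : (0 < enorm x < 1)%R -> (0 < k)%R ->
  (k `^ p * (enorm x ^+ n * w) = G `^ p)%R ->
  maximal (nu R n) g x <= ((p + 2) / (p - 2) * k)%:E.
Proof.
move=> /andP[x0 x1] k0 kE; apply: maximal_le.
  by rewrite mulr_ge0 ?(ltW C0)// ltW.
move=> r r0; under eq_integral do rewrite gee0_abs//.
apply: average_le => //; first by rewrite x0 ltW.
move=> y l kl lg; rewrite ltNge; apply/negP => ty.
have l0 := lt_trans k0 kl.
move: ty; set b := (p / 2 / n%:R)%R; set q := (k `^ b * l `^ (- b))%R => ty.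
have nR : (n%:R != 0 :> R)%R by rewrite pnatr_eq0 -lt0n.
have q0 : (0 < q)%R by rewrite mulr_gt0 ?powR_gt0.
have b0 : (0 < b)%R by rewrite !divr_gt0 ?ltr0n.
have qn : ((q ^+ 2) ^+ n = k `^ p * l `^ (- p))%R.
  rewrite -exprM /q exprMn -!powR_mulrn ?powR_ge0// -!powRrM mulNr.
  by rewrite natrM /b (_ : p / 2 / n%:R * (2 * n%:R) = p)%R//; field.
have q1 : (q < 1)%R.
  rewrite /q powRN ltr_pdivrMr ?powR_gt0// mul1r.
  by apply: gt0_ltr_powR; rewrite ?nnegrE ?ltW.
set t := (q ^+ 2 * enorm x)%R in ty.
have t0 : (0 < t)%R by rewrite mulr_gt0 ?exprn_gt0.
have t1 : (t < 1)%R.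
  by rewrite (le_lt_trans _ x1)// /t ler_piMl ?exprn_ile1
    ?(ltW x0) ?(ltW q0) ?(ltW q1).
have tG : (l `^ p * (t ^+ n * w) = G `^ p)%R.
  rewrite -kE /t exprMn qn powRN; field.
  by rewrite gt_eqF// powR_gt0.
(* Only at radius 0 may the profile be infinite, and [t > 0]. *)
have gt_fin : g0 t \is a fin_num by rewrite ge0_fin_numE ?g0_fin// g0_ge0// ltW.
have lc : (l < fine (g0 t))%R.
  rewrite -lte_fin fineK//; apply: lt_le_trans lg _.
  by rewrite gE; apply: g0_dec => //; exact: ltW.
have := @profile_le t (fine (g0 t)); rewrite t0 t1 fineK// lexx.
move=> /(_ isT (ltW (lt_trans l0 lc)) isT); rewrite -tG leNgt => /negP; apply.
rewrite ltr_pM2r ?mulr_gt0 ?exprn_gt0//.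
by apply: gt0_ltr_powR; rewrite ?nnegrE ?ltW// (lt_trans l0).
Qed.

(** If the maximal function exceeds [l] at [x], then [l < C k] with [k] the profile bound at [|x|].
    This confines [x] to the ball whose Lebesgue volume is [(C G / l)^p]. *)
Lemma weak_type_le :
  weak_Lnorm (nu R n) p%:E (maximal (nu R n) g) <= ((p + 2) / (p - 2) * G)%:E.
Proof.
apply/ereal_supP => _ [l /= l0 <-].
have := C0; set C := ((p + 2) / (p - 2))%R => Cp.
have nR : (n%:R != 0 :> R)%R by rewrite pnatr_eq0 -lt0n.
pose s := (C * G / l)%R.
have s0 : (0 < s)%R by rewrite divr_gt0 ?(mulr_gt0 Cp G0).
pose t := ((s `^ p / w) `^ (n%:R^-1))%R.
have sp0 : (0 < s `^ p)%R by rewrite powR_gt0.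
have t0 : (0 < t)%R by rewrite powR_gt0// divr_gt0.
have tn : (t ^+ n * w = s `^ p)%R.
  rewrite -powR_mulrn ?powR_ge0// -powRrM mulVf// powRr1 ?divfK ?gt_eqF//.
  by rewrite divr_ge0 ?ltW.
have le1 : nu R n [set x | l%:E < `|maximal (nu R n) g x|] <= (s `^ p)%:E.
  rewrite -tn EFinM -wE -volume_eball0//.
  apply: lebesgue_Rn_monotone => x [/= lM /in_eball0 x1]; apply/in_eball0.
  (* The origin, where [maximal_le_profile] does not apply, lies in the ball of radius [t]
     anyway. *)
  have [->//|x0] := eqVneq (enorm x) 0%R.
  have {}x0 : (0 < enorm x)%R by rewrite lt_neqAle eq_sym x0 enorm_ge0.
  have xn0 : (0 < enorm x ^+ n * w)%R by rewrite mulr_gt0 ?exprn_gt0.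
  pose k := ((G `^ p / (enorm x ^+ n * w)) `^ p^-1)%R.
  have k0 : (0 < k)%R by rewrite powR_gt0 ?divr_gt0 ?powR_gt0.
  have kE : (k `^ p * (enorm x ^+ n * w) = G `^ p)%R.
    rewrite -powRrM mulVf ?gt_eqF// powRr1 ?divfK ?gt_eqF//.
    by rewrite divr_ge0 ?powR_ge0// ltW.
  move: lM; rewrite gee0_abs ?maximal_ge0// => lM.
  have lk : (l < C * k)%R.
    rewrite -lte_fin; apply: lt_le_trans lM _; apply: maximal_le_profile => //.
    by rewrite x0.
  rewrite -(@ltr_pXn2r _ n)// ?nnegrE ?ltW// -(ltr_pM2r w0) tn.
  suff : (k `^ p * (enorm x ^+ n * w) < k `^ p * s `^ p)%R.
    by rewrite ltr_pM2l// powR_gt0.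
  have Gks : (G < k * s)%R.
    by rewrite /s mulrA ltr_pdivlMr// mulrCA mulrA [ltRHS]mulrC ltr_pM2l//.
  rewrite kE -powRM ?(ltW k0) ?(ltW s0)//; apply: gt0_ltr_powR => //.
    by rewrite nnegrE ltW.
  by rewrite nnegrE mulr_ge0 ?(ltW k0) ?(ltW s0).
rewrite (@le_trans _ _ (l%:E * (s `^ p)%:E `^ p^-1))//.
  rewrite lee_pmul2l// gt0_ler_poweR ?invr_ge0 ?(ltW p0)//.
  - by rewrite in_itv/= measure_ge0 leey.
  - by rewrite in_itv/= lee_fin powR_ge0 leey.
rewrite poweR_EFin -EFinM lee_fin -powRrM mulfV ?gt_eqF// powRr1 ?(ltW s0)//.
by rewrite /s mulrC divfK ?lexx// gt_eqF.
Qed.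

End finite_exponent.

(** The case of infinite exponent: an essential bound on [g] bounds all its averages. It is
    nonnegative because the unit ball has positive measure. *)
Lemma maximal_le_ae (c : \bar R) :
  (\forall y \ae nu R n, `|g y| <= c) ->
  (\forall x \ae nu R n, `|maximal (nu R n) g x| <= c).
Proof.
have mB : measurable B1 by exact: measurable_eball.
move=> gc; have c0 : 0 <= c.
  rewrite leNgt; apply/negP => c0; have [N [mN N0 cN]] := gc.
  have : nu R n B1 <= 0.
    rewrite -N0; apply: lebesgue_Rn_monotone => y [y1 _]; split => //.
    by apply: cN => /= /le_lt_trans/(_ c0); rewrite ltNge abse_ge0.
  by rewrite nu_eball0// expr1n mul1r lee_fin leNgt w0.
(* The complement of the unit ball is null for [nu R n]. *)
exists (~` B1); split.
- exact: measurableC.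
- by rewrite /nu /= /mrestr setICl measure0.
move=> x /=; apply: contra_not => /in_eball0 x1.
rewrite gee0_abs ?maximal_ge0//.
case: c c0 gc => [c| |] c0 gc //; last exact: leey.
apply: maximal_le; first by rewrite -lee_fin.
move=> r r0; apply: ae_integral_le_cst => //; last exact: measurable_eball.
Qed.

End maximal_radial.

(** * The weak-type inequality for all exponents *)

Theorem theorem2p7 (R : realType) (n : nat) (hn : (0 < n)%N)
    (g : Rn R n -> \bar R) (hg : radial_decreasing g)
    (p : \bar R) (hp : 2%:E < p) :
  weak_Lnorm (nu R n) p (maximal (nu R n) g)
  <= (weak_constant p)%:E * Lnorm (nu R n) p g.
Proof.
have [g0 [g0_ge0 g0_fin g0_dec gE]] := hg.
case: p hp => [p| |]//=; last first.
  move=> _; rewrite mul1e unlock; case: ifPn => // _.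
  apply: le_ereal_inf => c; exact: maximal_le_ae.
rewrite lte_fin => p2; have p0 : (0 < p)%R by apply: lt_trans p2.
have C0 : (0 < (p + 2) / (p - 2))%R by apply: divr_gt0; lra.
move: (Lnorm_ge0 (nu R n) p%:E g).
case LE : (Lnorm (nu R n) p%:E g) => [G| |]// G0; last first.
  by rewrite gt0_muley ?lte_fin// leey.
(* The norm [G] may vanish whereas [weak_type_le] wants a positive bound, so it is applied to
   [G + e / C] with [e] arbitrary. *)
rewrite lee_fin in G0.
apply/lee_addgt0Pr => e e0; rewrite -EFinM -EFinD.
set C := (_ / _)%R in C0 *.
have -> : (C * G + e = C * (G + e / C))%R by field; rewrite gt_eqF.
have Ge0 : (0 < G + e / C)%R by rewrite ltr_wpDl// divr_gt0.
apply: (weak_type_le hn g0_ge0 g0_fin g0_dec gE p2 Ge0).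
move: LE; rewrite unlock => LE.
set I := \int[_]_x _ in LE *.
have I0 : 0 <= I by apply: integral_ge0 => y _; exact: poweR_ge0.
(* The integral is recovered from the norm as [(I^(1 / p))^p]. *)
rewrite -[I]poweRe1// -(mulVf (lt0r_neq0 p0)) poweRrM LE -poweR_EFin.
apply: gt0_ler_poweR; first exact: ltW.
- by rewrite in_itv/= lee_fin G0 leey.
- by rewrite in_itv/= lee_fin leey ltW.
- by rewrite lee_fin lerDl divr_ge0// ltW.
Qed.
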